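(* Let $\mathcal T$ be a supercritical Galton-Watson tree, and let $\alpha_c$ be the critical value for Bernoulli parking on $\mathcal T$. Let $(\eta'(\alpha))$ be any other stochastically increasing family of nonnegative integer-valued car arrival distributions with $E\eta'(\alpha)=\alpha$ whose support does not include $\{1\}$, i.e. $P(\eta'(\alpha)=1)=0$ for all $\alpha$, and let $\alpha_c'$ be the critical value for parking on $\mathcal T$ with this family. Then $\alpha_c'\le\alpha_c$.
   Context: Parking process: on a tree $\mathcal T$ with root $\rho$, each vertex has one parking spot. Initially (time $0$) $\eta_v$ cars arrive to each vertex $v$. Cars move towards the root in discrete time, one edge per time step. When a car arrives at an available spot it parks there and the spot becomes unavailable; if several cars arrive at the same available spot simultaneously, one chosen uniformly at random parks there and the others continue towards the root. (This applies also to the cars arriving initially at a vertex.) $X\in\{0,1,\dots\}\cup\{\infty\}$ is the total number of cars that ever arrive to $\rho$, including the $\eta_\rho$ cars initially there. Setting: $\mathcal T$ is a Galton-Watson tree with nonnegative integer-valued offspring variable $Z$, $EZ=\lambda\in(1,\infty)$ (supercritical). The $\eta_v$ are i.i.d. with law $\eta(\alpha)$, independent of $\mathcal T$, where $(\eta(\alpha))$ is a family of nonnegative integer-valued random variables indexed by its mean $\alpha=E\eta(\alpha)$, with $\alpha$ ranging over an interval in $[0,\infty)$ containing $(0,1)$. It is stochastically increasing: $P(\eta(\alpha)\ge x)\le P(\eta(\beta)\ge x)$ for all $x\ge0$ and $\alpha\le\beta$. Bernoulli parking is the case in which $\eta(\alpha)$ equals $2$ with probability $\alpha/2$ and $0$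 otherwise, $\alpha\in[0,2]$. Critical value: for a given family, it is the number in $(0,1)$ such that $EX<\infty$ for $\alpha$ below it, while for $\alpha$ above it, conditionally on non-extinction of $\mathcal T$, $X=\infty$ almost surely (its existence is a theorem of Goldschmidt and Przykucki and is part of the standing assumptions). *)

(* Defs.v *)
From HB Require Import structures.
From mathcomp Require Import all_boot all_order all_algebra.
From mathcomp Require Import all_classical all_reals all_analysis.

Set Implicit Arguments.
Unset Strict Implicit.
Unset Printing Implicit Defensive.

Import Order.TTheory GRing.Theory Num.Theory.
Import numFieldNormedType.Exports.

Local Open Scope classical_set_scope.
Local Open Scope ring_scope.

(* Ulam-Harris labelling, with the most recent step at the head: the root is
   [::], the children of u are i :: u for i : nat, and the parent of i :: u
   is u. *)
Definition vertex := seq nat.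

(* In the tree with offspring numbers z, the children of u are the i :: u with
   i < z u. *)
Fixpoint in_tree (z : vertex -> nat) (u : vertex) : bool :=
  if u is i :: p then (i < z p)%N && in_tree z p else true.

(* The tree is locally finite, so it is infinite if and only if none of its
   generations is empty. *)
Definition nonextinct (z : vertex -> nat) : Prop :=
  infinite_set [set u | in_tree z u].

(* (v, i) is the i-th of the cars initially at v. *)
Definition car := (vertex * nat)%type.

(* At a given time: the cars arriving at each vertex at that time, and the
   spots that have become unavailable at an earlier time. *)
Record config := Config {
  arriving : vertex -> seq car ;
  taken : vertex -> bool
}.

Section Parking.
(* z u : number of children of u;  e v : number of cars initially at v;
   c v n : when n.+1 cars arrive simultaneously at v and the spot of v is
   available, the position (in {0, ..., n}) of the one that parks. *)
Variables (z e : vertex -> nat) (c : vertex -> nat -> nat).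

Definition initial_config : config :=
  Config (fun v => if in_tree z v then [seq (v, i) | i <- iota 0 (e v)]
                   else [::])
         (fun _ => false).

(* The cars that arrive at v, do not park there, and go on to the parent of v
   (or leave the tree if v is the root). *)
Definition departing (x : config) (v : vertex) : seq car :=
  let s := arriving x v in
  if taken x v then s
  else if s is _ :: s' then
    let j := c v (size s') in take j s ++ drop j.+1 s
  else [::].

Definition step (x : config) : config :=
  Config (fun v => flatten [seq departing x (i :: v) | i <- iota 0 (z v)])
         (fun v => taken x v || (arriving x v != [::])).

Definition config_at (t : nat) : config := iter t step initial_config.

(* A given car is at the root at one time at most, so the number of cars that
   ever arrive there is the sum over time of the number of arrivals. *)
Definition root_arrivals (R : realType) : \bar R :=
  (\sum_(0 <= t <oo) (size (arriving (config_at t) [::]))%:R%:E)%E.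

End Parking.

Definition mutually_independent d d' (T : measurableType d)
    (T' : measurableType d') (R : realType) (P : probability T R)
    (J : eqType) (X : J -> {RV P >-> T'}) : Prop :=
  forall (s : seq J) (A : J -> set T'), uniq s ->
    (forall j, measurable (A j)) ->
    (P (\bigcap_(j in [set` s]) (X j @^-1` A j)) =
     \prod_(j <- s) P (X j @^-1` A j))%E.

Definition has_law d d' (T : measurableType d) (T' : measurableType d')
    (R : realType) (P : probability T R) (X : {RV P >-> T'})
    (mu : probability T' R) : Prop :=
  forall A, measurable A -> distribution P X A = mu A.

Definition uniform_upto d (T : measurableType d) (R : realType)
    (P : probability T R) (X : {RV P >-> nat}) (n : nat) : Prop :=
  (forall w, (X w <= n)%N) /\
  (forall i, (i <= n)%N -> distribution P X [set i] = (n.+1%:R^-1)%:E).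

Definition mean (R : realType) (mu : probability nat R) : \bar R :=
  (\int[mu]_k k%:R%:E)%E.

(* The randomness of one parking process.  Each spot becomes unavailable only
   once, so at most one of the variables kappa v n, n : nat, is ever used at
   the vertex v: ties are broken uniformly, independently of everything
   else. *)
Definition parking_variables d (T : measurableType d) (R : realType)
    (P : probability T R) (mu nu : probability nat R)
    (zeta eta : vertex -> {RV P >-> nat})
    (kappa : vertex -> nat -> {RV P >-> nat}) : Prop :=
  [/\ forall u, has_law (zeta u) mu,
      forall v, has_law (eta v) nu,
      forall v n, uniform_upto (kappa v n) n &
      mutually_independent
        (fun j : vertex + vertex + vertex * nat =>
           match j with
           | inl (inl u) => zeta u
           | inl (inr v) => eta v
           | inr (v, n) => kappa v n
           end)].

Definition car_count d (T : measurableType d) (R : realType)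
    (P : probability T R) (zeta eta : vertex -> {RV P >-> nat})
    (kappa : vertex -> nat -> {RV P >-> nat}) (w : T) : \bar R :=
  root_arrivals (fun u => zeta u w) (fun v => eta v w)
    (fun v n => kappa v n w) R.

(* I is the set of parameters of the family eta. *)
Definition is_critical_value d (T : measurableType d) (R : realType)
    (P : probability T R) (I : set R) (zeta : vertex -> {RV P >-> nat})
    (eta : R -> vertex -> {RV P >-> nat})
    (kappa : vertex -> nat -> {RV P >-> nat}) (ac : R) : Prop :=
  [/\ 0 < ac < 1,
      forall a, I a -> a < ac ->
        (\int[P]_w car_count zeta (eta a) kappa w < +oo)%E &
      forall a, I a -> ac < a ->
        {ae P, forall w, nonextinct (fun u => zeta u w) ->
                         car_count zeta (eta a) kappa w = +oo%E}].

Definition car_family (R : realType) (I : set R)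
    (nu : R -> probability nat R) : Prop :=
  [/\ is_interval I, I `<=` [set a | 0 <= a], `]0, 1[ `<=` I,
      forall a, I a -> mean (nu a) = a%:E &
      forall a b, I a -> I b -> a <= b -> forall x : nat,
        (nu a [set k | (x <= k)%N] <= nu b [set k | (x <= k)%N])%E].

Definition double_bool (b : bool) : nat := if b then 2%N else 0%N.

Lemma measurable_double_bool : measurable_fun [set: bool] double_bool.
Proof. by []. Qed.

HB.instance Definition _ :=
  isMeasurableFun.Build _ _ _ _ double_bool measurable_double_bool.

(* 2 with probability a / 2 and 0 otherwise, for 0 <= a <= 2. *)
Definition bernoulli_parking (R : realType) (a : R) : probability nat R :=
  distribution (bernoulli_prob (a / 2)) double_bool.

Lemma bernoulli_parking2 (R : realType) (a : R) : 0 <= a <= 2 ->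
  bernoulli_parking a [set 2%N] = (a / 2)%:E.
Proof.
move=> /andP[a0 a2]; rewrite /bernoulli_parking /distribution /pushforward /=.
rewrite (_ : _ @^-1` _ = [set true]); last by apply/seteqP; split => -[].
rewrite /bernoulli_prob divr_ge0// ler_pdivrMr// mul1r a2/=.
by rewrite fsbig_set1.
Qed.

Lemma bernoulli_parking0 (R : realType) (a : R) : 0 <= a <= 2 ->
  bernoulli_parking a [set 0%N] = (1 - a / 2)%:E.
Proof.
move=> /andP[a0 a2]; rewrite /bernoulli_parking /distribution /pushforward /=.
rewrite (_ : _ @^-1` _ = [set false]); last by apply/seteqP; split => -[].
rewrite /bernoulli_prob divr_ge0// ler_pdivrMr// mul1r a2/=.
by rewrite fsbig_set1.
Qed.

(* Main.v *)
(* Whichever cars win the ties, the number of cars that visit v by time t is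
   a_t(v) = eta_v + sum over the children u of v of (a_{t-1}(u) - 1)^+, which is
   a convex function of each eta_u.  Among the laws with mean a that do not
   charge 1, the Bernoulli law on {0, 2} is minimal for convex functions, so
   replacing the initial numbers of cars one vertex at a time shows that the
   mean of X is smallest for Bernoulli parking.  If ac < a < ac', then E X is
   thus finite at a for Bernoulli parking, while X is infinite on
   non-extinction, an event of positive probability since lambda > 1.
   Expectations become iterated integrals over finitely many coordinates once
   both the depth of the tree and its numbers of children are capped by K; then
   K goes to infinity. *)

Require Import Defs.
From HB Require Import structures.
From mathcomp Require Import all_boot all_order all_algebra.
From mathcomp Require Import all_classical all_reals all_analysis.
From mathcomp Require Import measurable_realfun.
From mathcomp Require Import zify lra.

Set Implicit Arguments.
Unset Strict Implicit.
Unset Printing Implicit Defensive.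

Import Order.TTheory GRing.Theory Num.Theory.
Import numFieldNormedType.Exports.

Local Open Scope classical_set_scope.
Local Open Scope ring_scope.

(** * Iterated integrals over independent discrete variables *)

Lemma measurable_fun_natP d d' (T : measurableType d) (T' : measurableType d')
    (f : nat -> T -> T') (X : T -> nat) :
  measurable_fun setT X -> (forall k, measurable_fun setT (f k)) ->
  measurable_fun setT (fun w => f (X w) w).
Proof.
move=> mX mf _ A mA; rewrite setTI.
rewrite (_ : _ @^-1` _ = \bigcup_k (X @^-1` [set k] `&` (f k) @^-1` A)); last first.
  apply/seteqP; split => [w /= Aw|w [k _ [/= <-]]//]; exists (X w) => //.
apply: bigcup_measurable => k _; apply: measurableI.
  by rewrite -[_ @^-1` _]setTI; exact: mX.
by rewrite -[_ @^-1` _]setTI; exact: mf.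
Qed.

Lemma integral_preim_nat d (T : measurableType d) (R : realType)
    (P : {measure set T -> \bar R}) (X : T -> nat) (B : set T)
    (f : T -> \bar R) :
  measurable B -> measurable_fun setT X -> measurable_fun setT f ->
  (forall w, 0 <= f w)%E ->
  (\int[P]_(w in B) f w =
   \sum_(k <oo) \int[P]_(w in B `&` X @^-1` [set k]) f w)%E.
Proof.
move=> mB mX mf f0.
rewrite -ge0_integral_bigcup//.
- congr (integral _ _ _); apply/seteqP; split => [w Bw|w [k _ []]//].
  by exists (X w).
- move=> k; apply: measurableI => //.
  by rewrite -[_ @^-1` _]setTI; exact: mX.
- exact: (measurable_funS measurableT).
- by move=> i j _ _ [w [[_ /= <-] [_ /= <-]]].
Qed.

Lemma integral_natE (R : realType) (p : {measure set nat -> \bar R})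
    (f : nat -> \bar R) :
  (forall k, 0 <= f k)%E ->
  (\int[p]_k f k = \sum_(k <oo) f k * p [set k])%E.
Proof.
move=> f0; rewrite (@integral_preim_nat _ _ _ _ id)//.
apply: eq_eseriesr => k _; rewrite setTI preimage_id.
rewrite -[RHS]integral_cst//; apply: eq_integral => i.
by rewrite inE/= => ->.
Qed.

Lemma le_integral_nat (R : realType) (p : {measure set nat -> \bar R})
    (f g : nat -> \bar R) :
  (forall k, 0 <= f k)%E -> (forall k, f k <= g k)%E ->
  (\int[p]_k f k <= \int[p]_k g k)%E.
Proof. by move=> f0 fg; exact: ge0_le_integral. Qed.

Lemma mem_set_cons (T : eqType) (x : T) (s : seq T) :
  [set` x :: s] = x |` [set` s].
Proof.
apply/seteqP; split => y /=; rewrite inE; first by move=> /predU1P.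
by move=> [->|ys]; rewrite ?eqxx// ys orbT.
Qed.

Section IteratedIntegral.
Variables (R : realType) (J : eqType).
Implicit Types (p : J -> probability nat R) (s : seq J) (x : J -> nat)
  (F G : (J -> nat) -> \bar R).
Local Open Scope ereal_scope.

Definition upd x (j : J) (k : nat) : J -> nat :=
  fun i => if i == j then k else x i.

(** For a duplicate-free [s], integration against a finite product law, with the coordinates off [s]
    frozen at [x]. The recursion lets inequalities be proved one coordinate at a time. *)
Fixpoint iexp p s F x : \bar R :=
  if s is j :: s' then \int[p j]_k iexp p s' F (upd x j k) else F x.

Lemma iexp_ge0 p s F x : (forall y, 0 <= F y) -> 0 <= iexp p s F x.
Proof.
move=> F0; elim: s x => //= j s ih x; exact: integral_ge0.
Qed.

Lemma iexp_cst p s (c : \bar R) x : iexp p s (fun=> c) x = c.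
Proof.
elim: s x => //= j s ih x; rewrite (eq_integral (cst c)); last by move=> k _.
rewrite -[RHS]mule1 -(probability_setT (p j)).
exact: (integral_cst (p j) measurableT).
Qed.

Lemma iexp_cat p s1 s2 F x :
  iexp p (s1 ++ s2) F x = iexp p s1 (iexp p s2 F) x.
Proof. by elim: s1 x => //= j s ih x; apply: eq_integral => k _. Qed.

Lemma le_iexp p s F G x : (forall y, 0 <= F y) -> (forall y, 0 <= G y) ->
  (forall y, (forall i, i \notin s -> y i = x i) -> F y <= G y) ->
  iexp p s F x <= iexp p s G x.
Proof.
move=> F0 G0; elim: s x => [|j s ih] x FG /=; first exact: FG.
apply: le_integral_nat => k; first exact: iexp_ge0.
apply: ih => y yx; apply: FG => i.
by rewrite inE negb_or => /andP[ij /yx]; rewrite /upd (negPf ij).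
Qed.

Lemma iexpZl p s F x c : (forall y, 0 <= F y) -> 0 <= c ->
  iexp p s (fun y => c * F y) x = c * iexp p s F x.
Proof.
move=> F0 c0; elim: s x => //= j s ih x.
rewrite -ge0_integralZl//; last by move=> k _; exact: iexp_ge0.
by apply: eq_integral => k _.
Qed.

Lemma iexpD p s F G x : (forall y, 0 <= F y) -> (forall y, 0 <= G y) ->
  iexp p s (fun y => F y + G y) x = iexp p s F x + iexp p s G x.
Proof.
move=> F0 G0; elim: s x => //= j s ih x.
rewrite -ge0_integralD//; try by move=> k _; exact: iexp_ge0.
by apply: eq_integral => k _.
Qed.

Lemma updC x i j k l : i != j -> upd (upd x i k) j l = upd (upd x j l) i k.
Proof.
move=> ij; apply/funext => h; rewrite /upd; case: eqP => // ->.
by rewrite eq_sym (negPf ij).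
Qed.

Lemma iexp_upd p s F x j k : j \notin s ->
  iexp p s F (upd x j k) = iexp p s (fun y => F (upd y j k)) x.
Proof.
elim: s x => //= i s ih x; rewrite inE negb_or => /andP[ji js].
by apply: eq_integral => l _; rewrite -ih// updC.
Qed.

Definition override s (y x : J -> nat) : J -> nat :=
  fun i => if i \in s then y i else x i.

Lemma override_cons j s y x :
  override (j :: s) y x = override s y (upd x j (y j)).
Proof.
by apply/funext => i; rewrite /override /upd inE; case: eqP => [->|//]; case: ifP.
Qed.

(** * Expectations as iterated integrals *)

Section Representation.
Variables (d : measure_display) (T : measurableType d) (P : probability T R).
Variables (X : J -> {RV P >-> nat}) (p : J -> probability nat R).
Hypothesis indepX : mutually_independent X.
Hypothesis lawX : forall j, has_law (X j) (p j).

(** Each coordinate takes countably many values; splitting on them one coordinate at a time ends at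
    a constant. *)
Lemma measurable_override s F x :
  measurable_fun setT (fun w => F (override s (X^~ w) x)).
Proof.
elim: s x => [|j s ih] x.
  by rewrite /override /=; exact: measurable_cst.
under eq_fun do rewrite override_cons.
by apply: (@measurable_fun_natP _ _ _ _
  (fun k w => F (override s (X^~ w) (upd x j k)))).
Qed.

(* Conditioning on the values of the first coordinates puts them in the event B,
   which must therefore be independent of the remaining ones. *)
Lemma integral_override_setI (B : set T) s F x : (forall y, 0 <= F y) ->
  measurable B -> uniq s ->
  (forall A : J -> set nat, P (B `&` \bigcap_(j in [set` s]) (X j @^-1` A j)) =
     P B * \prod_(j <- s) P (X j @^-1` A j)) ->
  \int[P]_(w in B) F (override s (X^~ w) x) = P B * iexp p s F x.
Proof.
move=> F0; elim: s B x => [|j s ih] B x mB /=.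
  by move=> _ _; rewrite muleC -integral_cst.
move=> /andP[js us] indepB.
rewrite (integral_preim_nat _ mB (measurable_funPT (X j)))//; last exact: measurable_override.
have PXj k : P (X j @^-1` [set k]) = p j [set k] by exact: lawX.
have mX k : measurable (X j @^-1` [set k]).
  by rewrite -[_ @^-1` _]setTI; exact: measurable_funPT.
(* Independence tested with [[set k]] at [j] and the full space at the entries of [s]. *)
have PBX k : P (B `&` X j @^-1` [set k]) = P B * p j [set k].
  have := indepB (fun i => if i == j then [set k] else setT).
  rewrite mem_set_cons bigcap_setU1 big_cons eqxx PXj.
  rewrite (_ : \bigcap_(i in _) _ = setT); last first.
    apply/seteqP; split => // w _ i /= si; rewrite ifF//.
    by apply/negbTE/eqP => ij; rewrite -ij si in js.
  rewrite setIT big1_seq ?mule1// => i /= si; rewrite ifF//.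
    by rewrite preimage_setT probability_setT.
  by apply/negbTE/eqP => ij; rewrite -ij si in js.
have eqk k : \int[P]_(w in B `&` X j @^-1` [set k])
      F (override (j :: s) (X^~ w) x) =
    P B * (iexp p s F (upd x j k) * p j [set k]).
  transitivity (\int[P]_(w in B `&` X j @^-1` [set k])
      F (override s (X^~ w) (upd x j k))).
    by apply: eq_integral => w; rewrite inE override_cons => -[_ /= ->].
  rewrite ih//; [by rewrite PBX -muleA (muleC (iexp _ _ _ _))|exact: measurableI|].
  (* [B] cut by [X j = k] is again independent of the coordinates in [s]: use the hypothesis on [B]
     with [[set k]] at [j]. *)
  move=> A; rewrite PBX.
  have := indepB (fun i => if i == j then [set k] else A i).
  rewrite mem_set_cons bigcap_setU1 big_cons eqxx PXj setIA muleA.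
  have eqA i : i \in s -> (if i == j then [set k] else A i) = A i.
    by move=> si; rewrite ifF//; apply/negbTE/eqP => ij; rewrite -ij si in js.
  rewrite (eq_bigcapr (F := fun i => _ @^-1` (if i == j then _ else _))
    (G := fun i => X i @^-1` A i)); last first.
    by move=> i si; rewrite (eqA i si).
  by move=> ->; congr (_ * _); apply: eq_big_seq => i si; rewrite (eqA i si).
rewrite (eq_eseriesr (fun k _ => eqk k)).
have PBfin : P B \is a fin_num by exact: fin_num_measure.
rewrite -(fineK PBfin) nneseriesZl ?integral_natE// => k *; try exact: iexp_ge0.
by apply: mule_ge0 => //; exact: iexp_ge0.
Qed.

Lemma integral_iexp s F x : (forall y, 0 <= F y) -> uniq s ->
  (forall y z, {in s, y =1 z} -> F y = F z) ->
  \int[P]_w F (X^~ w) = iexp p s F x.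
Proof.
move=> F0 us Fs.
rewrite -[RHS]mul1e -(probability_setT P) -integral_override_setI//.
  by apply: eq_integral => w _; apply: Fs => i si; rewrite /override si.
by move=> A; rewrite setTI probability_setT mul1e; exact: indepX.
Qed.

Lemma measurable_finite_support s F :
  (forall y z, {in s, y =1 z} -> F y = F z) ->
  measurable_fun setT (fun w => F (X^~ w)).
Proof.
move=> Fs; rewrite (_ : (fun w => _) =
  (fun w => F (override s (X^~ w) (fun=> 0%N)))); first exact: measurable_override.
by apply/funext => w; apply: Fs => i si; rewrite /override si.
Qed.

End Representation.

End IteratedIntegral.

(** * Cars arriving in a fixed environment *)

Section TotalArrivals.
Implicit Types (z e : vertex -> nat) (v : vertex).
Local Open Scope nat_scope.

(** The truncated [.-1] is a positive part: one car stays at each visited child, and the others come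
    one time unit later. *)
Fixpoint arrivals (t : nat) z e v : nat :=
  if t is t'.+1 then e v + \sum_(i < z v) (arrivals t' z e (nat_of_ord i :: v)).-1
  else e v.

Lemma leq_arrivals t t' z z' e v : t <= t' -> (forall u, z u <= z' u) ->
  arrivals t z e v <= arrivals t' z' e v.
Proof.
move=> + zz'; elim: t t' v => [|t ih] [|t'] v //= tt'; first exact: leq_addr.
rewrite leq_add2l (big_ord_widen _ (fun i => (arrivals t z e (i :: v)).-1) (zz' v)).
rewrite big_mkcond/=; apply: leq_sum => i _; case: ifP => // _.
by have := ih t' (nat_of_ord i :: v) tt'; lia.
Qed.

(** The map n -> (n - 1)^+ is nondecreasing and convex, so it preserves the convexity inequality
    with weights 2/k and 1 - 2/k, here multiplied by [k] to stay in [nat]. *)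
Lemma leq_pred_convex (k a0 a2 ak : nat) :
  1 < k -> k * a2 <= 2 * ak + (k - 2) * a0 ->
  k * a2.-1 <= 2 * ak.-1 + (k - 2) * a0.-1.
Proof.
move=> k1; case: a2 => [|a2] H; first by rewrite muln0.
rewrite /=.
case: ak H => [|ak]; case: a0 => [|a0]; nia.
Qed.

Lemma arrivals_convex t z e u v k : 1 < k ->
  k * arrivals t z (upd e u 2) v <=
    2 * arrivals t z (upd e u k) v + (k - 2) * arrivals t z (upd e u 0) v.
Proof.
(* Both sides are equal: 2k at [u], and k times [e w] elsewhere. *)
move=> k1; have updH w : k * upd e u 2 w <=
    2 * upd e u k w + (k - 2) * upd e u 0 w.
  by rewrite /upd; case: eqP => _; [lia|rewrite -mulnDl subnKC].
elim: t v => [|t ih] v //=.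
rewrite !mulnDr !big_distrr/= addnACA; apply: leq_add => //.
rewrite -big_split/=; apply: leq_sum => i _; exact: leq_pred_convex.
Qed.

(* The descendants of v up to t generations below, in the K-ary tree. *)
Fixpoint box (K t : nat) v : seq vertex :=
  if t is t'.+1 then v :: flatten [seq box K t' (i :: v) | i <- iota 0 K]
  else [:: v].

Lemma box_suffix K t v u : u \in box K t v -> suffix v u.
Proof.
elim: t v => [|t ih] v /=; first by rewrite inE => /eqP ->; exact: suffix_refl.
rewrite inE => /predU1P[->|/flattenP[s /mapP[i _ ->] /ih]]; first exact: suffix_refl.
by move/suffixP => [s' ->]; apply/suffixP; exists (rcons s' i); rewrite cat_rcons.
Qed.

(** Labels grow at the head, so descendants have their ancestor as a suffix; a vertex below two
    siblings would have two different suffixes of the same length. *)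
Lemma box_uniq K t v : uniq (box K t v).
Proof.
elim: t v => //= t ih v; apply/andP; split.
  apply/negP => /flattenP[s /mapP[i _ ->] /box_suffix /size_suffix/=].
  by rewrite ltnn.
elim: (iota 0 K) (iota_uniq 0 K) => //= i r ihr /andP[ir ur].
rewrite cat_uniq ih ihr// andbT; apply/hasPn => u.
move=> /flattenP[s /mapP[j jr ->] /box_suffix/suffixP[s1 ->]].
apply/negP => /box_suffix/suffixP[s2].
rewrite -!cat_rcons => eq_s.
have eq_size : size (rcons s1 j) = size (rcons s2 i).
  by move/(congr1 size): eq_s; rewrite !size_cat; lia.
move/eqP: eq_s; rewrite eqseq_cat// => /andP[/eqP/rcons_inj[_ ji] _].
by rewrite -ji jr in ir.
Qed.

(** With at most [K] children per vertex the recursion reads only the box, so the capped count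
    depends on finitely many coordinates. *)
Lemma eq_arrivals K t z z' e e' v :
  (forall u, z u <= K) -> {in box K t v, z =1 z'} -> {in box K t v, e =1 e'} ->
  arrivals t z e v = arrivals t z' e' v.
Proof.
move=> zK; elim: t v => [|t ih] v /= ez ee; first by apply: ee; rewrite inE.
rewrite -ee ?inE ?eqxx// -ez ?inE ?eqxx//; congr (_ + _).
apply: eq_bigr => i _; congr _.-1.
have sub : {subset box K t (nat_of_ord i :: v) <= box K t.+1 v}.
  move=> u ub /=; rewrite inE; apply/orP; right; apply/flattenP.
  exists (box K t (nat_of_ord i :: v)) => //; apply/mapP; exists (nat_of_ord i) => //.
  by rewrite mem_iota/= add0n (leq_trans (ltn_ord i)).
by apply: ih => u /sub; [exact: ez|exact: ee].
Qed.

Definition capped_arrivals (K : nat) z e : nat :=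
  arrivals K (fun v => minn (z v) K) e [::].

Lemma capped_arrivals_nondecreasing K K' z e : K <= K' ->
  capped_arrivals K z e <= capped_arrivals K' z e.
Proof. by move=> KK'; apply: leq_arrivals => // u; lia. Qed.

Lemma capped_arrivals_le K z e : capped_arrivals K z e <= arrivals K z e [::].
Proof. by apply: leq_arrivals => // u; lia. Qed.

Lemma arrivals_cap t z e v :
  exists K0, forall K, K0 <= K ->
    arrivals t (fun u => minn (z u) K) e v = arrivals t z e v.
Proof.
elim: t v => [|t ih] v; first by exists 0.
have /choice[f fP] : forall i, exists K0, forall K, K0 <= K ->
    arrivals t (fun u => minn (z u) K) e (i :: v) = arrivals t z e (i :: v).
  by move=> i; exact: ih.
(* The cap must reach the degree of [v] and the thresholds of its finitely many children. *)
exists (maxn (z v) (\max_(i < z v) f i)) => K; rewrite geq_max => /andP[zK fK] /=.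
rewrite (minn_idPl zK); congr (_ + _); apply: eq_bigr => i _; rewrite fP//.
by apply: leq_trans fK; exact: (leq_bigmax i).
Qed.

Lemma arrivals_le_capped t z e :
  exists K, arrivals t z e [::] <= capped_arrivals K z e.
Proof.
have [K0 KP] := arrivals_cap t z e [::].
exists (maxn t K0); rewrite -(KP (maxn t K0)) ?leq_maxr//.
by apply: leq_arrivals => //; exact: leq_maxl.
Qed.

(** * Cumulative arrivals in the parking process *)

Section Process.
Variables (z e : vertex -> nat) (c : vertex -> nat -> nat).
Hypothesis c_le : forall v n, c v n <= n.
Let arrived t v := size (arriving (config_at z e c t) v).
Let departed t v := size (departing c (config_at z e c t) v).

Lemma departedE t v :
  departed t v = arrived t v - ~~ taken (config_at z e c t) v.
Proof.
rewrite /departed /departing /arrived.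
case: (taken _ v) => /=; first by rewrite subn0.
case: (arriving _ v) => //= a s; rewrite size_cat size_take size_drop/=.
by have := c_le v (size s); case: ifP; lia.
Qed.

Lemma takenE t v :
  taken (config_at z e c t) v = (0 < \sum_(s < t) arrived s v).
Proof.
elim: t => [|t ih]; first by rewrite big_ord0.
rewrite big_ord_recr/= ih addn_gt0; congr (_ || _).
by rewrite /arrived; case: (arriving _ _).
Qed.

(** Once cars have come, exactly one of them has stayed, whichever cars win the ties. *)
Lemma sum_departed t v :
  \sum_(s < t) departed s v = (\sum_(s < t) arrived s v).-1.
Proof.
elim: t => [|t ih]; first by rewrite !big_ord0.
rewrite !big_ord_recr/= ih departedE takenE.
by case: (\sum_(s < t) _) => [|n] /=; lia.
Qed.

Lemma sum_arrived t v : in_tree z v ->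
  \sum_(s < t.+1) arrived s v = arrivals t z e v.
Proof.
elim: t v => [|t ih] v vT.
  by rewrite big_ord1/= /arrived /= vT size_map size_iota.
rewrite big_ord_recl/= {1}/arrived/= vT size_map size_iota; congr (_ + _).
(* Arrivals at time s + 1 are the departures from the children at time s; exchanging the sums leaves
   the total departures of each child. *)
under eq_bigr => s _.
  rewrite /arrived/= size_flatten /shape -map_comp sumnE big_map.
  rewrite -[X in iota 0 X]subn0 -/(index_iota 0 (z v)) big_mkord; over.
rewrite exchange_big/=; apply: eq_bigr => i _.
rewrite -ih ?sum_departed//= vT ltn_ord//.
Qed.

End Process.
End TotalArrivals.

(** * Minimality of the Bernoulli law *)

Section ConvexComparison.
Variable R : realType.
Local Open Scope ereal_scope.

(* Convexity of g tested at the points 0 <= 2 <= k only, which is all that the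
   comparison with the law on {0, 2} needs. *)
Definition convex0_2 (g : nat -> \bar R) : Prop := forall k, (1 < k)%N ->
  k%:R%:E * g 2%N <= 2%:R%:E * g k + (k - 2)%:R%:E * g 0%N.

Lemma mean_lt1_pos0 (nu : probability nat R) (a : R) :
  mean nu = a%:E -> (a < 1)%R -> 0 < nu [set 0%N].
Proof.
move=> nua a1; rewrite lt0e measure_ge0 andbT; apply/eqP => nu0.
suff : 1%:E <= mean nu by rewrite nua lee_fin leNgt a1.
have <- : \int[nu]_(k in ~` [set 0%N]) cst 1%:E k = 1%:E.
  rewrite integral_cst// mul1e.
  by rewrite -[LHS]/(nu (~` [set 0%N])) probability_setC// nu0 sube0.
rewrite (le_trans (y := \int[nu]_(k in ~` [set 0%N]) k%:R%:E))//.
  by apply: ge0_le_integral => //= k /eqP; rewrite lee_fin ler1n lt0n.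
by apply: ge0_subset_integral => // k _; rewrite lee_fin.
Qed.

Lemma integral_bernoulli_parking (a : R) (g : nat -> \bar R) :
  (0 <= a <= 2)%R -> (forall k, 0 <= g k) ->
  \int[bernoulli_parking a]_k g k =
  (a / 2)%:E * g 2%N + (1 - a / 2)%:E * g 0%N.
Proof.
move=> /andP[a0 a2] g0.
rewrite /bernoulli_parking ge0_integral_pushforward//.
by rewrite preimage_setT integral_bernoulli_prob//= divr_ge0//= ler_pdivrMr// mul1r.
Qed.

(** The line through the graph of [g] at 0 and 2 lies below [g] at every integer except possibly 1.
    Its integral depends on the law only through the mean, and equals that of [g] for the law on {0,
    2}. *)
Lemma le_integral_bernoulli_parking (nu : probability nat R) (a : R)
    (g : nat -> \bar R) :
  mean nu = a%:E -> (0 <= a < 1)%R -> nu [set 1%N] = 0 ->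
  (forall k, 0 <= g k) -> convex0_2 g ->
  \int[bernoulli_parking a]_k g k <= \int[nu]_k g k.
Proof.
move=> nua /andP[a0 a1] nu1 g0 cvx.
rewrite integral_bernoulli_parking//; last by lra.
(* A finite g(0) can be cancelled below; if it is infinite, so is the right-hand side, because
   [a < 1] forces mass at 0. *)
have [goo|gfin] := eqVneq (g 0%N) +oo.
  suff -> : \int[nu]_k g k = +oo by exact: leey.
  apply/eqP; rewrite -leye_eq.
  have <- : \int[nu]_(k in [set 0%N]) cst +oo k = +oo.
    by rewrite integral_cst// gt0_mulye// (mean_lt1_pos0 nua a1).
  rewrite (eq_integral g); last by move=> k; rewrite inE/= => ->.
  exact: ge0_subset_integral.
have g0fin : g 0%N \is a fin_num by rewrite ge0_fin_numE// ltey.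
have nuaE : \int[nu]_k k%:R%:E = a%:E by exact: nua.
(* [2 g(k) + k g(0) >= 2 g(0) + k g(2)] for every k != 1, integrated. *)
have key : 2%:R%:E * g 0%N + a%:E * g 2%N <=
    2%:R%:E * (\int[nu]_k g k) + a%:E * g 0%N.
  have -> : 2%:R%:E * g 0%N + a%:E * g 2%N =
      \int[nu]_k (2%:R%:E * g 0%N + k%:R%:E * g 2%N).
    rewrite ge0_integralD//; [|by move=> *; apply: mule_ge0..].
    rewrite -nuaE -ge0_integralZr//; congr (_ + _).
    rewrite -[LHS]mule1 -(probability_setT nu).
    exact/esym/(integral_cst nu measurableT).
  have -> : 2%:R%:E * (\int[nu]_k g k) + a%:E * g 0%N =
      \int[nu]_k (2%:R%:E * g k + k%:R%:E * g 0%N).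
    rewrite ge0_integralD//; [|by move=> *; apply: mule_ge0..].
    by rewrite -nuaE -ge0_integralZr// -ge0_integralZl.
  rewrite !integral_natE//; [|by move=> *; apply: adde_ge0; apply: mule_ge0..].
  apply: lee_nneseries => [k _ _|[|[|k]] _].
  - by apply: mule_ge0 => //; apply: adde_ge0; apply: mule_ge0.
  - by rewrite !mul0e.
  - by rewrite [X in _ * X <= _]nu1 [X in _ <= _ * X]nu1 !mule0.
  - apply: lee_wpmul2r => //.
    (* Adding 2 g(0) to the convexity inequality turns the coefficient k of g(0) into k + 2. *)
    rewrite addeC (le_trans (leeD2r _ (cvx k.+2 isT)))// -addeA leeD2l//.
    by rewrite -ge0_muleDl ?lee_fin// -EFinD -natrD subn2 addn2.
rewrite -(lee_pmul2l (x := 2%:R%:E))// -(leeD2rE (x := a%:E * g 0%N)) ?fin_numM//.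
apply: le_trans key.
rewrite ge0_muleDr ?mule_ge0 ?lee_fin ?divr_ge0//; [|lra].
rewrite !muleA -!EFinM -addeA -ge0_muleDl ?lee_fin//; [|lra].
rewrite (_ : 2 * (a / 2) = a)%R; last by lra.
by rewrite addeC -EFinD (_ : 2 * (1 - a / 2) + a = 2)%R//; lra.
Qed.

Definition parking_law (mu nu : probability nat R) (j : vertex + vertex) :=
  if j is inl _ then mu else nu.

(** The inequality is linear with nonnegative coefficients, so it survives integration over the
    other coordinates. *)
Lemma iexp_convex0_2 (J : eqType) (p : J -> probability nat R) s F j :
  (forall y, 0 <= F y) -> j \notin s ->
  (forall x, convex0_2 (fun k => F (upd x j k))) ->
  forall x, convex0_2 (fun k => iexp p s F (upd x j k)).
Proof.
move=> F0 js cvx x k k1.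
rewrite !iexp_upd// -!iexpZl// -iexpD; [|by move=> *; apply: mule_ge0..].
by apply: le_iexp => [y|y|y _]; [exact: mule_ge0|apply: adde_ge0; exact: mule_ge0|exact: cvx].
Qed.

Lemma le_iexp_bernoulli (mu nu : probability nat R) (a : R) s F x :
  mean nu = a%:E -> (0 <= a < 1)%R -> nu [set 1%N] = 0 ->
  uniq s -> (forall y, 0 <= F y) ->
  (forall x v, convex0_2 (fun k => F (upd x (inr v) k))) ->
  iexp (parking_law mu (bernoulli_parking a)) s F x <=
  iexp (parking_law mu nu) s F x.
Proof.
move=> nua a01 nu1 + F0 cvx; elim: s x => //= j s ih x /andP[js us].
(* The inner laws are exchanged first, by induction, then that of [j], which changes only if [j] is
   some [inr v]. *)
apply: (@le_trans _ _ (\int[parking_law mu (bernoulli_parking a) j]_k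
    iexp (parking_law mu nu) s F (upd x j k))).
  by apply: ge0_le_integral => // k _; [exact: iexp_ge0|exact: ih].
case: j js => // v vs; apply: le_integral_bernoulli_parking => //.
- by move=> k; exact: iexp_ge0.
- exact: iexp_convex0_2.
Qed.

End ConvexComparison.

(** * Survival of supercritical trees *)

Section GaltonWatsonSurvival.
Variable R : realType.
Implicit Types (z : vertex -> nat) (v : vertex).

Fixpoint survives (n : nat) z v : bool :=
  if n is n'.+1 then has (fun i => survives n' z (i :: v)) (iota 0 (z v))
  else true.

Lemma survivesW n z v : survives n.+1 z v -> survives n z v.
Proof.
elim: n v => // n ih v /hasP[i iz siv]; apply/hasP; exists i => //; exact: ih.
Qed.

Lemma sub_survives n z z' v : (forall u, z u <= z' u)%N ->
  survives n z v -> survives n z' v.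
Proof.
move=> zz'; elim: n v => //= n ih v /hasP[i]; rewrite mem_iota => iz siv.
apply/hasP; exists i; last exact: ih.
by rewrite mem_iota/= add0n (leq_trans _ (zz' v)).
Qed.

Lemma survives_in_tree n z v : in_tree z v -> survives n z v ->
  exists2 u, in_tree z u & size u = (n + size v)%N.
Proof.
elim: n v => [|n ih] v vT; first by exists v.
move=> /hasP[i]; rewrite mem_iota add0n => /andP[_ iz] siv.
have [|u uT su] := ih (i :: v) _ siv; first by rewrite /= iz.
by exists u => //; rewrite su/= addnS.
Qed.

Lemma survives_nonextinct z : (forall n, survives n z [::]) -> nonextinct z.
Proof.
move=> sz fin; have := infinite_nat; apply.
rewrite (_ : setT = size @` [set u | in_tree z u]); first exact: finite_image.
apply/seteqP; split => // n _.
have [|u uT su] := @survives_in_tree n z [::] _ (sz n); first by [].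
by exists u => //; rewrite su addn0.
Qed.

Lemma eq_survives K n z z' v : (forall u, z u <= K)%N ->
  {in box K n v, z =1 z'} -> survives n z v = survives n z' v.
Proof.
move=> zK; elim: n v => //= n ih v ez.
rewrite -ez ?inE ?eqxx//; apply: eq_in_has => i; rewrite mem_iota add0n => /andP[_ iz].
apply: ih => u ub; apply: ez; rewrite inE; apply/orP; right; apply/flattenP.
exists (box K n (i :: v)) => //; apply: map_f.
by rewrite mem_iota/= add0n (leq_trans iz).
Qed.

(** The bound (1 - e)^j <= 1 - e j + (e j)^2, with e j on the left so that both sides integrate as
    sums of nonnegative terms. *)
Lemma exp_le_quadratic (e : R) (j : nat) : 0 <= e <= 1 ->
  (1 - e) ^+ j + e * j%:R <= 1 + (e * j%:R) ^+ 2.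
Proof.
move=> /andP[e0 e1]; elim: j => [|j ih]; first by rewrite expr0; nra.
rewrite exprS -natr1.
have j0 : 0 <= j%:R :> R by [].
set X := (1 - e) ^+ j in ih *; set J := j%:R in ih j0 *.
have : (1 - e) * (X + e * J) <= (1 - e) * (1 + (e * J) ^+ 2).
  by apply: ler_wpM2l => //; lra.
rewrite !expr2.
have : 0 <= e * (e * J * (e * J)) by nra.
have : 0 <= e * e * J by nra.
nra.
Qed.

Local Open Scope ereal_scope.

(** The capped means increase to [lambda], so they cannot all be at most 1. *)
Lemma truncated_mean_gt1 (mu : probability nat R) (lambda : R) :
  mean mu = lambda%:E -> (1 < lambda)%R ->
  exists K, 1 < \int[mu]_k (minn k K)%:R%:E.
Proof.
move=> mul l1; apply/not_existsP => K1.
have : mean mu <= 1%:E.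
  rewrite /mean (_ : \int[mu]_k _ = \int[mu]_k limn (fun K => (minn k K)%:R%:E)); last first.
    apply: eq_integral => k _; apply/esym/lim_near_cst => //.
    by exists k => // K /= kK; rewrite (minn_idPl kK).
  rewrite monotone_convergence//.
    apply: lime_le; last by apply: nearW => K; rewrite leNgt; apply/negP/K1.
    apply: ereal_nondecreasing_is_cvgn => K K' KK'.
    by apply: le_integral_nat => // k; rewrite lee_fin ler_nat; lia.
  by move=> k _ K K' KK'; rewrite lee_fin ler_nat; lia.
by rewrite mul lee_fin leNgt l1.
Qed.

(** The capped offspring law has mean above 1, so its generating function dips below the diagonal
    just left of 1. *)
Lemma subcritical_point (mu : probability nat R) (lambda : R) :
  mean mu = lambda%:E -> (1 < lambda)%R ->
  exists K (s : R), (0 <= s < 1)%R /\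
    \int[mu]_k (s ^+ minn k K)%:E <= s%:E.
Proof.
move=> mul l1; have [K] := truncated_mean_gt1 mul l1.
set m := \int[mu]_k _ => m1; exists K.
have cstE (c : R) : \int[mu]_k c%:E = c%:E.
  by rewrite -[RHS]mule1 -(probability_setT mu); exact: (integral_cst mu measurableT).
have mfin : m \is a fin_num.
  rewrite ge0_fin_numE; last by apply: integral_ge0 => k _; rewrite lee_fin.
  apply: (@le_lt_trans _ _ (\int[mu]_k K%:R%:E)); last by rewrite cstE ltey.
  by rewrite /m; apply: le_integral_nat => // k; rewrite lee_fin ler_nat geq_minr.
move: m1; rewrite -(fineK mfin); set M := fine m => m1.
have {}m1 : (1 < M)%R by rewrite -lte_fin.
(* The generating function at 1 - e is at most 1 - e M + (e K)^2, so any small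
   e with e K^2 <= M - 1 works. *)
pose e := ((M - 1) / (K%:R ^+ 2 + M))%R.
have KK : (0 <= K%:R ^+ 2 :> R)%R by exact: sqr_ge0.
have den0 : (0 < K%:R ^+ 2 + M)%R by lra.
have e0 : (0 < e)%R by apply: divr_gt0; lra.
have e1 : (e < 1)%R by rewrite ltr_pdivrMr//; lra.
have eK : (e * K%:R ^+ 2 <= M - 1)%R.
  rewrite /e mulrAC ler_pdivrMr//; nra.
clearbody e; exists (1 - e)%R; split; first lra.
have s0 n : (0 <= (1 - e) ^+ n)%R by apply: exprn_ge0; lra.
have : \int[mu]_k (((1 - e) ^+ minn k K)%:E + e%:E * (minn k K)%:R%:E) <=
    \int[mu]_k (1 + (e * K%:R) ^+ 2)%:E.
  apply: le_integral_nat => // k.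
    by rewrite -EFinM -EFinD lee_fin addr_ge0// mulr_ge0// ltW.
  rewrite -EFinM -EFinD lee_fin (le_trans (exp_le_quadratic _ _)); [|lra|] => //.
  have : ((minn k K)%:R <= K%:R :> R)%R by rewrite ler_nat geq_minr.
  have : (0 <= (minn k K)%:R :> R)%R by [].
  rewrite lerD2l !exprMn; move=> h0 h1; apply: ler_wpM2l; first exact: sqr_ge0.
  by rewrite ler_sqr ?nnegrE.
rewrite cstE ge0_integralD//; [|by move=> k _; rewrite lee_fin// mulr_ge0// ltW..].
rewrite ge0_integralZl//; [|by rewrite lee_fin ltW].
rewrite -/m -(fineK mfin) -/M -leeBrDr// => /le_trans; apply.
rewrite -EFinM -EFinB lee_fin exprMn; nra.
Qed.

Section Extinction.
Variables (mu : probability nat R) (K : nat) (s : R).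
Hypotheses (s01 : (0 <= s < 1)%R)
  (sub_s : \int[mu]_k (s ^+ minn k K)%:E <= s%:E).

Let p := fun _ : vertex => mu.

Definition extinct n v (z : vertex -> nat) : \bar R :=
  (~~ survives n (fun u => minn (z u) K) v)%:R%:E.

(** Each factor reads only its own block and the blocks are disjoint, so the factors integrate
    separately. *)
Lemma iexp_prod (I : eqType) (J : eqType) (q : J -> probability nat R)
    (r : seq I) (B : I -> seq J) (G : I -> (J -> nat) -> \bar R)
    (c : I -> \bar R) x :
  uniq (flatten [seq B i | i <- r]) ->
  (forall i y, 0 <= G i y) -> (forall i, 0 <= c i) ->
  (forall i y y', {in B i, y =1 y'} -> G i y = G i y') ->
  (forall i y, iexp q (B i) (G i) y <= c i) ->
  iexp q (flatten [seq B i | i <- r]) (fun y => \prod_(i <- r) G i y) x <=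
  \prod_(i <- r) c i.
Proof.
move=> + G0 c0 GB Gc; elim: r x => [|i r ih] x /=; first by rewrite !big_nil.
rewrite cat_uniq => /and3P[_ disj ur]; rewrite iexp_cat big_cons.
set s' := flatten _ in disj ur ih *.
have P0 y : 0 <= \prod_(j <- r) G j y by apply: prode_ge0 => j _; exact: G0.
have C0 : 0 <= \prod_(j <- r) c j by apply: prode_ge0 => j _.
apply: (@le_trans _ _ (iexp q (B i) (fun y => \prod_(j <- r) c j * G i y) x)).
  apply: le_iexp => [y|y|y _].
  - by apply: iexp_ge0 => y1; rewrite big_cons mule_ge0.
  - by rewrite mule_ge0.
  - apply: (@le_trans _ _ (iexp q s' (fun y1 => G i y * \prod_(j <- r) G j y1) y)).
      apply: le_iexp => [y1|y1|y1 y1y]; [by rewrite big_cons mule_ge0|by rewrite mule_ge0|].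
      rewrite big_cons (GB i y1 y)// => j jB; apply: y1y.
      by apply: contra disj => js; apply/hasP; exists j.
    by rewrite iexpZl// muleC; apply: lee_wpmul2r => //; exact: ih.
by rewrite iexpZl// muleC; apply: lee_wpmul2r.
Qed.

Lemma eq_extinct n v z z' :
  {in box K n v, z =1 z'} -> extinct n v z = extinct n v z'.
Proof.
move=> zz'; congr (~~ _)%:R%:E.
apply: (@eq_survives K); first by move=> u; rewrite geq_minr.
by move=> u /zz' ->.
Qed.

(** The probability q_n of extinction by generation n obeys q_0 = 0 and q_(n+1) = f(q_n), with f the
    capped generating function; as f is nondecreasing and f(s) <= s, the bound [s] persists. *)
Lemma iexp_extinct n v x : iexp p (box K n v) (extinct n v) x <= s%:E.
Proof.
have /andP[s0 s1] := s01.
have ext0 n' v' y : 0 <= extinct n' v' y by rewrite lee_fin.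
elim: n v x => [|n ih] v x.
  rewrite /= (eq_integral (cst 0)); last by move=> k _.
  by rewrite integral0 lee_fin.
have [/= vnot ub] := andP (box_uniq K n.+1 v).
rewrite /=; apply: le_trans sub_s.
apply: le_integral_nat => // k; first exact: iexp_ge0.
(* Positions i >= k hold no child and get the factor 1, so the product runs over [iota 0 K] whatever
   k is. *)
pose G i (y : vertex -> nat) := if (i < k)%N then extinct n (i :: v) y else 1.
pose c (i : nat) : \bar R := if (i < k)%N then s%:E else 1.
have -> : (s ^+ minn k K)%:E = \prod_(i <- iota 0 K) c i.
  elim: K => [|K' ihK]; first by rewrite minn0 big_nil.
  rewrite -addn1 iotaD big_cat/= big_seq1 -ihK /c add0n.
  case: ltnP => kK; last by rewrite mule1; congr (_ ^+ _)%:E; lia.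
  by rewrite -EFinM -exprSr; congr (_ ^+ _)%:E; lia.
apply: (@le_trans _ _ (iexp p (flatten [seq box K n (i :: v) | i <- iota 0 K])
    (fun y => \prod_(i <- iota 0 K) G i y) (upd x v k))); last first.
  apply: iexp_prod => //.
  - by move=> i y; rewrite /G; case: ifP.
  - by move=> i; rewrite /c; case: ifP => // _; rewrite lee_fin.
  - move=> i y y' yy'; rewrite /G; case: ifP => // _; exact: eq_extinct.
  - move=> i y; rewrite /G /c; case: ifP => _; first exact: ih.
    by rewrite iexp_cst.
apply: le_iexp => // [y|y yx].
  by apply: prode_ge0 => i _; rewrite /G; case: ifP.
have yv : y v = k by rewrite yx// /upd eqxx.
rewrite /extinct /= yv.
have G0 i : 0 <= G i y by rewrite /G; case: ifP.
have [sv|/hasPn nsv] := boolP (has _ _); first exact: prode_ge0.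
rewrite big1_seq// => i; rewrite mem_iota add0n => /andP[_ iK].
rewrite /G; case: ifP => // ik; rewrite /extinct.
by rewrite (nsv i)// mem_iota add0n leq_min ik.
Qed.

End Extinction.
End GaltonWatsonSurvival.

(** * Expected number of cars *)

Section CarCount.
Variables (R : realType) (d : measure_display) (T : measurableType d).
Variable P : probability T R.
Local Open Scope ereal_scope.

Lemma mutually_independent_inl (J J' : eqType)
    (X : J + J' -> {RV P >-> nat}) :
  mutually_independent X -> mutually_independent (fun j => X (inl j)).
Proof.
move=> indX s A us mA.
have := indX (map inl s) (fun j => if j is inl i then A i else setT).
rewrite map_inj_uniq// => [/(_ us)|i j []//].
rewrite big_map => <-; last by case.
congr (P _); apply/seteqP; split => w Aw => [_ /mapP[j js ->]|j js].
  exact: Aw.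
by apply: (Aw (inl j)); exact: map_f.
Qed.

Section ParkingProcess.
Variables (mu nu : probability nat R) (zeta eta : vertex -> {RV P >-> nat})
  (kappa : vertex -> nat -> {RV P >-> nat}).
Hypothesis vars : parking_variables mu nu zeta eta kappa.

Let X (j : vertex + vertex) : {RV P >-> nat} :=
  match j with inl u => zeta u | inr v => eta v end.

Let indepX : mutually_independent X.
Proof.
have [_ _ _ /mutually_independent_inl] := vars.
by congr mutually_independent; apply/funext => -[].
Qed.

Let lawX j : has_law (X j) (parking_law mu nu j).
Proof. by have [lz le _ _] := vars; case: j => u /=. Qed.

Definition capped_count (K : nat) (x : vertex + vertex -> nat) : \bar R :=
  (capped_arrivals K (x \o inl) (x \o inr))%:R%:E.

Definition capped_support (K : nat) : seq (vertex + vertex) :=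
  map inl (box K K [::]) ++ map inr (box K K [::]).

Lemma capped_support_uniq K : uniq (capped_support K).
Proof.
rewrite cat_uniq !map_inj_uniq ?box_uniq//=; [|by move=> ? ? []..].
by rewrite andbT; apply/hasPn => _ /mapP[u _ ->]; apply/negP => /mapP[].
Qed.

Lemma eq_capped_count K x y :
  {in capped_support K, x =1 y} -> capped_count K x = capped_count K y.
Proof.
move=> xy; rewrite /capped_count /capped_arrivals; congr _%:R%:E.
apply: (@eq_arrivals K) => [u|u ub|u ub]; first exact: geq_minr.
  by rewrite /= xy// mem_cat map_f.
by rewrite /= xy// mem_cat map_f ?orbT.
Qed.

Let count_at K w := capped_count K (X^~ w).

Lemma integral_capped_count K :
  \int[P]_w count_at K w =
  iexp (parking_law mu nu) (capped_support K) (capped_count K) (fun=> 0%N).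
Proof.
apply: (integral_iexp indepX lawX (F := capped_count K)) => [y||].
- by rewrite lee_fin.
- exact: capped_support_uniq.
- exact: eq_capped_count.
Qed.

Lemma measurable_count_at K : measurable_fun setT (count_at K).
Proof.
exact: (@measurable_finite_support _ _ _ _ _ X _ _ (@eq_capped_count K)).
Qed.

Lemma count_at_nondecreasing w : nondecreasing_seq (count_at^~ w).
Proof.
by move=> K K' KK'; rewrite lee_fin ler_nat; exact: capped_arrivals_nondecreasing.
Qed.

(** Two suprema that dominate each other: arrivals by time t are at most some capped count, and the
    count capped at [K] is at most the arrivals by time [K]. *)
Lemma car_countE w :
  car_count zeta eta kappa w = limn (count_at^~ w).
Proof.
have [_ _ kap _] := vars.
have kap_le v n : (kappa v n w <= n)%N by exact: (kap v n).1.
have count_arrived t : \sum_(0 <= n < t.+1)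
    (size (arriving (config_at (zeta^~ w) (eta^~ w)
      (fun v n => kappa v n w) n) [::]))%:R%:E =
    (arrivals t (zeta^~ w) (eta^~ w) [::])%:R%:E :> \bar R.
  by rewrite sumEFin -natr_sum big_mkord (sum_arrived _ kap_le).
rewrite (cvg_lim _ (ereal_nondecreasing_cvgn (count_at_nondecreasing w)))//.
apply/eqP; rewrite eq_le; apply/andP; split.
- apply: lime_le; first exact: is_cvg_nneseries.
  apply: nearW => -[|t].
    rewrite big_geq//; apply: (@le_trans _ _ (count_at 0%N w)).
      by rewrite lee_fin.
    by apply: ereal_sup_ubound; exists 0%N.
  rewrite count_arrived.
  have [K leK] := arrivals_le_capped t (zeta^~ w) (eta^~ w).
  apply: (@le_trans _ _ (count_at K w)); first by rewrite lee_fin ler_nat.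
  by apply: ereal_sup_ubound; exists K.
- apply: ub_ereal_sup => _ [K _ <-].
  apply: le_trans (nneseries_lim_ge K.+1 _) => //.
  by rewrite count_arrived lee_fin ler_nat; exact: capped_arrivals_le.
Qed.

Lemma measurable_car_count : measurable_fun setT (car_count zeta eta kappa).
Proof.
apply: (emeasurable_fun_cvg count_at); first exact: measurable_count_at.
move=> w _; rewrite car_countE; apply: ereal_nondecreasing_is_cvgn.
exact: count_at_nondecreasing.
Qed.

(** Both the list and the integrand vary with [K]; monotonicity is read off the integrals over
    [P]. *)
Lemma is_cvg_iexp_capped_count :
  cvgn (fun K =>
    iexp (parking_law mu nu) (capped_support K) (capped_count K) (fun=> 0%N)).
Proof.
apply: ereal_nondecreasing_is_cvgn => K K' KK'.
rewrite -!integral_capped_count; apply: ge0_le_integral => //.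
- by move=> w _; rewrite lee_fin.
- exact: measurable_count_at.
- exact: measurable_count_at.
- by move=> w _; exact: count_at_nondecreasing.
Qed.

(** By monotone convergence the mean is expressed through the laws alone, in a form where they can
    be exchanged. *)
Lemma integral_car_count :
  \int[P]_w car_count zeta eta kappa w = limn (fun K =>
    iexp (parking_law mu nu) (capped_support K) (capped_count K) (fun=> 0%N)).
Proof.
under eq_integral do rewrite car_countE.
rewrite monotone_convergence//.
- by congr (limn _); apply/funext => K; exact: integral_capped_count.
- exact: measurable_count_at.
- by move=> K w _; rewrite lee_fin.
- by move=> w _; exact: count_at_nondecreasing.
Qed.

Lemma car_count_ae_fin_num :
  \int[P]_w car_count zeta eta kappa w < +oo ->
  {ae P, forall w, car_count zeta eta kappa w \is a fin_num}.
Proof.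
move=> fin_int.
have count0 w : 0 <= car_count zeta eta kappa w by exact: nneseries_ge0.
have int_count : P.-integrable setT (car_count zeta eta kappa).
  apply/integrableP; split; first exact: measurable_car_count.
  by under eq_integral do rewrite gee0_abs//.
by apply: filterS (integrable_ae measurableT int_count) => w; apply.
Qed.

(** Extinction of the capped tree has probability at most [s < 1], and the capped tree sits inside
    the original one. *)
Lemma not_ae_extinct (lambda : R) : mean mu = lambda%:E -> (1 < lambda)%R ->
  ~ {ae P, forall w, ~ nonextinct (zeta^~ w)}.
Proof.
move=> mul l1 [N [mN PN subN]].
have [K [s [/andP[s0 s1] sub_s]]] := subcritical_point mul l1.
pose D n := [set w | ~~ survives n (fun u => minn (zeta u w) K) [::]].
have indz : mutually_independent zeta.
  exact: (mutually_independent_inl indepX).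
have lawz u : has_law (zeta u) mu by exact: (lawX (inl u)).
have mE n : measurable_fun setT (fun w => extinct R K n [::] (zeta^~ w)).
  apply: (@measurable_finite_support _ _ _ _ _ zeta (box K n [::])).
  exact: eq_extinct.
have Dpre n : D n = (fun w => extinct R K n [::] (zeta^~ w)) @^-1` [set 1].
  apply/seteqP; split => w; rewrite /D/= /extinct; first by move=> ->.
  by case: survives => //= -[]/eqP; rewrite eq_sym oner_eq0.
have mD n : measurable (D n).
  by rewrite Dpre -[_ @^-1` _]setTI; exact: mE.
have PD n : P (D n) <= s%:E.
  have intE : \int[P]_w extinct R K n [::] (zeta^~ w) <= s%:E.
    rewrite (integral_iexp indz lawz (F := extinct R K n [::]) (fun=> 0%N)
      _ (box_uniq K n [::])) => [|y|].
    - by apply: iexp_extinct; rewrite ?s0.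
    - by rewrite lee_fin.
    - exact: eq_extinct.
  apply: le_trans intE; rewrite -[D n]setIT -(integral_indic P measurableT)//.
  apply: ge0_le_integral => //.
    exact/measurable_EFinP/measurable_indic.
  move=> w _; rewrite indicE /extinct lee_fin ler_nat.
  by case: (boolP (w \in D n)) => //= /set_mem ->.
have ndD : nondecreasing_seq D.
  apply/nondecreasing_seqP => n; apply/subsetPset => w /=.
  by apply: contra; exact: survivesW.
have mU : measurable (\bigcup_n D n) by exact: bigcup_measurable.
have PU : P (\bigcup_n D n) <= s%:E.
  have cvgD := nondecreasing_cvg_mu (mu := P) mD mU ndD.
  rewrite -(cvg_lim _ cvgD)//; apply: lime_le; last exact: nearW.
  by apply/cvg_ex; exists (P (\bigcup_n D n)).
have : P setT <= s%:E.
  rewrite (_ : setT = \bigcup_n D n `|` N).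
    apply: le_trans (measureU2 P mU mN) _; by rewrite [X in _ + X]PN adde0.
  (* Off the union of the [D n] the tree is infinite, which puts [w] in the null set [N]. *)
  apply/esym/seteqP; split => // w _.
  have [Dw|nDw] := pselect ((\bigcup_n D n) w); [by left|right].
  apply: subN => /= ext; apply: ext; apply: survives_nonextinct => n.
  apply: (@sub_survives _ (fun u => minn (zeta u w) K)) => [u|].
    exact: geq_minl.
  by apply/negPn/negP => Dn; apply: nDw; exists n.
by rewrite probability_setT lee_fin leNgt s1.
Qed.

End ParkingProcess.
End CarCount.

(** * Comparison of the two critical values *)

Theorem corollary8 (R : realType) (d : measure_display) (T : measurableType d)
    (P : probability T R)
    (mu : probability nat R) (lambda : R)
    (I' : set R) (nu' : R -> probability nat R)
    (zeta : vertex -> {RV P >-> nat})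
    (eta eta' : R -> vertex -> {RV P >-> nat})
    (kappa : vertex -> nat -> {RV P >-> nat})
    (ac ac' : R) :
  mean mu = lambda%:E -> 1 < lambda ->
  car_family I' nu' ->
  (forall a, I' a -> nu' a [set 1%N] = 0%E) ->
  (forall a : R, `[0, 2]%classic a ->
     parking_variables mu (bernoulli_parking a) zeta (eta a) kappa) ->
  (forall a, I' a -> parking_variables mu (nu' a) zeta (eta' a) kappa) ->
  is_critical_value `[0, 2]%classic zeta eta kappa ac ->
  is_critical_value I' zeta eta' kappa ac' ->
  ac' <= ac.
Proof.
move=> mul l1 [_ _ sub01 mean_nu' _] nu'1 vars vars'.
move=> [/andP[ac0 ac1] _ supercrit] [/andP[ac'0 ac'1] subcrit' _].
rewrite leNgt; apply/negP => acac'.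
pose a := (ac + ac') / 2.
have a_gt : ac < a by rewrite /a; lra.
have a_lt : a < ac' by rewrite /a; lra.
have I'a : I' a by apply: sub01; rewrite /= in_itv/=; apply/andP; split; lra.
have I2a : `[0, 2]%classic a by rewrite /= in_itv/=; apply/andP; split; lra.
have fin_count : (\int[P]_w car_count zeta (eta a) kappa w < +oo)%E.
  apply: le_lt_trans (subcrit' a I'a a_lt).
  rewrite (integral_car_count (vars a I2a)) (integral_car_count (vars' a I'a)).
  (* The two means are compared at each cap [K], where only finitely many laws are exchanged. *)
  apply: lee_lim.
  - exact: (is_cvg_iexp_capped_count (vars a I2a)).
  - exact: (is_cvg_iexp_capped_count (vars' a I'a)).
  apply: nearW => K; apply: le_iexp_bernoulli.
  - exact: mean_nu'.
  - by apply/andP; split; lra.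
  - exact: nu'1.
  - exact: capped_support_uniq.
  - by move=> y; rewrite lee_fin.
  - move=> x v k k1; rewrite /capped_count -!EFinM -EFinD lee_fin -!natrM -natrD ler_nat.
    exact: arrivals_convex.
(* At [a] the Bernoulli count is almost surely finite, yet infinite on non-extinction, so extinction
   would be almost sure. *)
apply: (not_ae_extinct (vars a I2a) mul l1).
apply: filterS2 (car_count_ae_fin_num (vars a I2a) fin_count) (supercrit a I2a a_gt).
by move=> w fin_w + surv_w => /(_ surv_w) count_oo; rewrite count_oo in fin_w.
Qed.
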